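(* Let $(\mathcal{S},\Gamma)$ be a self-organizing multi-agent system and let $out$ be a set of computations whose dependence graph $G$ is acyclic, with decomposition $(L_0,L_1,\dots,L_h)$ of $(\mathcal{S},\Gamma)$ w.r.t. $out$. Then for any $a\in L_i$ and $b\in L_j$ ($0\le i,j\le h$): (i) if $i=j$, then $a$ and $b$ do not get input from each other; (ii) if $b$ gets input from $a$, then $i<j$.
   Context: A concurrent game structure is a tuple $\mathcal{S}=(k,Q,\pi,\Pi,ACT,d,\delta)$ where: $k\ge 1$ is the number of agents, $\Sigma=\{1,\dots,k\}$ is the set of agents; $Q$ is a finite set of states; $\Pi$ is a finite set of propositions; $\pi(q)\subseteq\Pi$ is the set of propositions true at $q\in Q$; $ACT$ is a finite set of actions; $d_i(q)\subseteq ACT$ is the non-empty set of actions available to agent $i$ in $q$, and $D(q)=d_1(q)\times\dots\times d_k(q)$ is the set of joint actions; $\delta(q,\langle\alpha_1,\dots,\alpha_k\rangle)\in Q$ is the successor state for each $q\in Q$ and $\langle\alpha_1,\dots,\alpha_k\rangle\in D(q)$. A computation is an infinite sequence $\lambda=q_0,q_1,\dots$ of states such that for every $i\ge 0$ there is a joint action in $D(q_i)$ leading by $\delta$ from $q_i$ to $q_{i+1}$; $q\in\lambda$ means that $q$ occurs in $\lambda$. Each agent $i$ has an internal function $m_i$ mapping each state $q$ to a propositional formula over $\pi(q)$. An abstract local rule for agent $a$ is a pair $\langle\tau_a,\gamma_a\rangle$, where $\tau_a(q)\subseteq\Sigma$ for each state $q$ (the agents with whom $a$ communicates), and $\gamma_a$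 maps $M(q)=\{m_i(q)\mid i\in\tau_a(q)\}$ to an action $\gamma_a(M(q))\in d_a(q)$. $\Gamma$ is the set of all abstract local rules (one for each agent). A self-organizing multi-agent system is a pair $(\mathcal{S},\Gamma)$. The dependence graph w.r.t. a set of computations $out$ is the directed graph $G(V,E)$ with $V=\Sigma$ and $E=\{(a,b)\mid \text{there exist }\lambda\in out\text{ and }q\in\lambda\text{ with }a\in\tau_b(q)\}$. An edge $(a,b)\in E$ means that $b$ gets input from $a$, and then $a$ is called a parent of $b$. For $G$ a directed acyclic graph, the layer function $\rho:V\to\mathbb{N}$ is defined by $\rho(a)=0$ if $a$ has no parent in $G$, and $\rho(a)=\max\{\rho(p)+1 : p\text{ is a parent of }a\}$ otherwise; $h=\max\{\rho(a):a\in V\}$. The decomposition of $(\mathcal{S},\Gamma)$ w.r.t. $out$ is the tuple $(L_0,L_1,\dots,L_h)$ with $L_i=\{a\in\Sigma\mid\rho(a)=i\}$ for $0\le i\le h$. *)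

(* Defs.v *)
From mathcomp Require Import all_boot.
From mathcomp Require Import boolp classical_sets.

Set Implicit Arguments.
Unset Strict Implicit.
Unset Printing Implicit Defensive.

Definition acyclic (V : finType) (e : rel V) : Prop :=
  forall c : seq V, cycle e c -> c = [::].

Lemma acyclic_wf (V : finType) (e : rel V) : acyclic e -> well_founded e.
Proof.
move=> ac.
have lt_anc p a : e p a -> #|[pred x | connect e x p]| < #|[pred x | connect e x a]|.
  move=> epa; apply/proper_card/properP; split.
    apply/fintype.subsetP=> x; rewrite !inE => xp.
    exact: connect_trans xp (connect1 epa).
  exists a; rewrite !inE ?connect0 //; apply/negP => /connectP[s es ps].
  have := ac (a :: s); rewrite /= rcons_path es -ps epa => /(_ isT).
  by [].
suff ac_lt n : forall a, #|[pred x | connect e x a]| < n -> Acc e a.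
  by move=> a; exact: ac_lt (ltnSn _).
elim: n => [a|n IHn a le_an]; first by rewrite ltn0.
constructor=> p epa; apply: IHn.
exact: leq_trans (lt_anc _ _ epa) le_an.
Qed.

(* Well-founded recursion along the edges; the subtype {p | e p a} of parents
   of a carries the proof of e p a that the recursive call needs. *)
Definition layer (V : finType) (e : rel V) (ac : acyclic e) : V -> nat :=
  Fix (acyclic_wf ac) (fun=> nat) (fun a rec =>
    if [exists p, e p a]
    then \max_(p : {p : V | e p a}) (rec (val p) (valP p)).+1
    else 0).

Definition height (V : finType) (e : rel V) (ac : acyclic e) : nat :=
  \max_(a : V) layer ac a.

Definition layer_decomposition (V : finType) (e : rel V) (ac : acyclic e) :
    (height ac).+1.-tuple {set V} :=
  [tuple [set a : V | layer ac a == i]%SET | i < (height ac).+1].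

Inductive formula (P : Type) : Type :=
  | Atom of P
  | Top
  | Bot
  | Neg of formula P
  | And of formula P & formula P
  | Or of formula P & formula P
  | Imp of formula P & formula P.

Fixpoint formula_over (P : finType) (A : {set P}) (f : formula P) : bool :=
  match f with
  | Atom p => p \in A
  | Top | Bot => true
  | Neg g => formula_over A g
  | And g1 g2 | Or g1 g2 | Imp g1 g2 => formula_over A g1 && formula_over A g2
  end.

Definition joint_actions (k : nat) (Q ACT : finType)
    (d : 'I_k -> Q -> {set ACT}) (q : Q) : {set {ffun 'I_k -> ACT}} :=
  [set alpha : {ffun 'I_k -> ACT} | [forall i, alpha i \in d i q]]%SET.

Record cgs := CGS {
  num_agents : nat;
  num_agents_gt0 : 0 < num_agents;
  state : finType;
  proposition : finType;
  labelling : state -> {set proposition};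
  action : finType;
  available : 'I_num_agents -> state -> {set action};
  available_neq0 : forall i q, available i q != finset.set0;
  transition : forall q : state,
    {alpha : {ffun 'I_num_agents -> action} | alpha \in joint_actions available q}
    -> state
}.

Definition agent (S : cgs) : finType := 'I_(num_agents S).

Definition computation (S : cgs) (lambda : nat -> state S) : Prop :=
  forall n, exists alpha, lambda n.+1 = transition (q := lambda n) alpha.

Record internal_functions (S : cgs) := InternalFunctions {
  internal :> agent S -> state S -> formula (proposition S);
  internal_over : forall i q, formula_over (labelling q) (internal i q)
}.

Definition messages (S : cgs) (m : internal_functions S)
    (tau : state S -> {set agent S}) (q : state S)
    : set (formula (proposition S)) :=
  [set phi | exists2 i, i \in tau q & phi = m i q]%classic.

(* gamma is total on sets of formulas, but only its values on the message sets
   are constrained. *)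
Record local_rule (S : cgs) (m : internal_functions S) (a : agent S) :=
  LocalRule {
    tau : state S -> {set agent S};
    gamma : set (formula (proposition S)) -> action S;
    gamma_available : forall q, gamma (messages m tau q) \in available a q
  }.

Record somas := SOMAS {
  structure :> cgs;
  internals : internal_functions structure;
  rules : forall a : agent structure, local_rule internals a
}.

Definition dependence_graph (S : somas) (out : set (nat -> state S))
    : rel (agent S) :=
  fun a b => `[< exists lambda, out lambda /\
                 exists n, a \in tau (rules b) (lambda n) >].

Definition gets_input_from (S : somas) (out : set (nat -> state S))
    (b a : agent S) : bool :=
  dependence_graph out a b.

(* Main.v *)
Require Import Defs.
From mathcomp Require Import all_boot.
From mathcomp Require Import boolp classical_sets.

(** Every edge of the graph strictly raises the layer, since the layer of a vertex with parents is a
    maximum of terms rho(p)+1, one for each parent p ([layer_lt]). Input runs along an edge from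
    giver to receiver, so (ii) is this inequality read on the indices; for (i), an edge in either
    direction within one layer would give i < i. *)

Lemma layerE (V : finType) (e : rel V) (ac : acyclic e) (a : V) :
  layer ac a = if [exists p, e p a]
               then \max_(p : {p : V | e p a}) (layer ac (val p)).+1 else 0.
Proof.
(* [Fix_eq] asks that the recursion body depend only on the values of its recursive argument, so
   that pointwise equal [f] and [g] give the same result. *)
rewrite [LHS]Fix_eq // => x f g fg.
by case: ifP => // _; apply: eq_bigr => p _; rewrite fg.
Qed.

Lemma layer_lt (V : finType) (e : rel V) (ac : acyclic e) (p a : V) :
  e p a -> layer ac p < layer ac a.
Proof.
move=> epa; rewrite (layerE _ _ ac a) ifT; last by apply/existsP; exists p.
(* The edge proof [epa] makes [p] an index of the maximum, which thus bounds its term. *)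
exact: (leq_bigmax (F := fun q : {q | e q a} => (layer ac (val q)).+1)
          (exist _ p epa)).
Qed.

Lemma mem_layer_decomposition (V : finType) (e : rel V) (ac : acyclic e)
    (i : 'I_(height ac).+1) (a : V) :
  (a \in tnth (layer_decomposition ac) i) = (layer ac a == i).
Proof. by rewrite tnth_mktuple inE. Qed.

Theorem proposition4p3 (S : somas) (out : set (nat -> state S))
    (out_comp : forall lambda, out lambda -> computation lambda)
    (ac : acyclic (dependence_graph out))
    (i j : 'I_(height ac).+1) (a b : agent S)
    (aLi : a \in tnth (layer_decomposition ac) i)
    (bLj : b \in tnth (layer_decomposition ac) j) :
  (i = j -> ~ gets_input_from out a b /\ ~ gets_input_from out b a) /\
  (gets_input_from out b a -> i < j).
Proof.
move: aLi bLj; rewrite !mem_layer_decomposition => /eqP ai /eqP bj.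
split=> [ij | /(layer_lt _ _ ac)]; last by rewrite ai bj.
by split=> /(layer_lt _ _ ac); rewrite ai bj ij ltnn.
Qed.
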